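(* Let $G$ be a graph and let $v$ be a vertex of $G$. Assume that the independence polynomials $I(\mathrm{Tail}(G,v,1);t)$ and $I(G;t)$ are unimodal with modes $\nu_1^v(G)$ and $\nu$, respectively, satisfying $0\le \nu_1^v(G)-\nu\leq 1$. Then $I(\mathrm{Tail}(G,v,n);t)$ is unimodal for all $n\geq 1$. Moreover, denoting by $\nu_n^v(G)$ the mode of $I(\mathrm{Tail}(G,v,n);t)$, one has $0\le \nu_n^v(G)-\nu_{n-1}^v(G)\leq 1$ for all $n\geq 2$.
   Context: Graphs are finite and simple. For a graph $G$, a vertex $v$ of $G$ and $n\geq 1$, the $n$-tail graph $\mathrm{Tail}(G,v,n)$ of $G$ at $v$ is obtained from the disjoint union of $G$ and the path $P_n$ on $n$ vertices $v_1,\ldots,v_n$ (edges $\{v_j,v_{j+1}\}$) by adding the edge $\{v,v_1\}$. The independence polynomial of a graph $G$ is $I(G;t)=\sum_{k\ge 0} s_k(G)t^k$, where $s_k(G)$ is the number of independent sets (sets of pairwise nonadjacent vertices) of size $k$ in $G$; $s_0(G)=1$. A nonzero polynomial $\sum_{k=0}^{N}a_kx^k$ with nonnegative real coefficients is unimodal if there is an integer $p$ with $a_0\leq a_1\leq\cdots\leq a_p\geq a_{p+1}\geq\cdots\geq a_N$. Setting $a_{-1}=0$, its mode is the unique integer $i\in\{0,\ldots,N\}$ with $a_{i-1}<a_i\geq a_{i+1}\geq\cdots\geq a_N$. *)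

(* Defs.v *)
From HB Require Import structures.
From mathcomp Require Import all_boot all_order all_algebra.

Set Implicit Arguments.
Unset Strict Implicit.
Unset Printing Implicit Defensive.

Import Order.TTheory GRing.Theory Num.Theory.
Local Open Scope ring_scope.

Record sgraph := SGraph {
  vertex :> finType;
  edge : rel vertex;
  edge_sym : symmetric edge;
  edge_irrefl : irreflexive edge
}.

Section Tail.
Variables (G : sgraph) (v : G) (n : nat).

(* The path vertex v_j is [inr j'] with j' = j - 1. *)
Definition tail_edge (x y : G + 'I_n) : bool :=
  match x, y with
  | inl a, inl b => edge a b
  | inr i, inr j => (i.+1 == j :> nat) || (j.+1 == i :> nat)
  | inl a, inr j => (a == v) && (j == 0 :> nat)
  | inr i, inl b => (b == v) && (i == 0 :> nat)
  end.

Lemma tail_edge_sym : symmetric tail_edge.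
Proof. by move=> [a|i] [b|j] //=; [exact: edge_sym | rewrite orbC]. Qed.

Lemma tail_edge_irrefl : irreflexive tail_edge.
Proof.
by move=> [a|i] /=; [exact: edge_irrefl | rewrite orbb gtn_eqF].
Qed.

Definition Tail : sgraph := SGraph tail_edge_sym tail_edge_irrefl.

End Tail.

Definition independent (G : sgraph) (S : {set G}) : bool :=
  [forall x in S, forall y in S, ~~ edge x y].

Definition indep_count (G : sgraph) (k : nat) : nat :=
  #|[set S : {set G} | independent S & #|S| == k]|.

Definition indep_poly (G : sgraph) : {poly int} :=
  \poly_(k < #|G|.+1) (indep_count G k)%:R.

Section Unimodal.
Variable R : realDomainType.
Implicit Type p : {poly R}.

Definition deg p : nat := (size p).-1.

Definition unimodal p : Prop :=
  [/\ p != 0,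
      forall i, 0 <= p`_i
    & exists2 m : nat, (m <= deg p)%N &
        (forall i, (i < m)%N -> p`_i <= p`_i.+1) /\
        (forall i, (m <= i < deg p)%N -> p`_i.+1 <= p`_i)].

(* The coefficient of index i - 1, with the convention a_{-1} = 0. *)
Definition coef_pred p (i : nat) : R := if i is j.+1 then p`_j else 0.

Definition is_mode p (i : nat) : bool :=
  [&& (i <= deg p)%N,
      coef_pred p i < p`_i
    & [forall j : 'I_(deg p), (i <= j)%N ==> (p`_j.+1 <= p`_j)]].

(* The default value 0 is irrelevant on nonzero polynomials with nonnegative
   coefficients: see [modeP] and [is_mode_uniq]. *)
Definition mode p : nat :=
  if [pick i : 'I_(deg p).+1 | is_mode p i] is Some i then val i else 0%N.

Lemma is_mode_uniq p i j : is_mode p i -> is_mode p j -> i = j.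
Proof.
wlog ij : i j / (i < j)%N => [H Hi Hj|].
  by case: (ltngtP i j) => // h; [exact: H | symmetry; exact: H].
case/and3P=> _ _ /forallP Hi /and3P[]; case: j ij => // j ij jN /= jlt _.
have /implyP/(_ ij) := Hi (Ordinal jN); by rewrite /= leNgt jlt.
Qed.

Lemma modeP p : p != 0 -> (forall i, 0 <= p`_i) -> is_mode p (mode p).
Proof.
move=> p0 pge0; rewrite /mode; case: pickP => // none; exfalso.
have lead0 : 0 < p`_(deg p).
  by rewrite lt_neqAle pge0 andbT eq_sym; move: p0; rewrite -lead_coef_eq0.
have ub i : (i <= deg p)%N && (coef_pred p i < p`_i) -> (i <= deg p)%N.
  by case/andP.
have ex : exists i, (i <= deg p)%N && (coef_pred p i < p`_i).
  have : exists i, 0 < p`_i by exists (deg p).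
  move=> /ex_minnP[m mpos mmin]; exists m; apply/andP; split; first exact: mmin.
  case: m mpos mmin => //= m mpos mmin; apply: le_lt_trans mpos.
  by rewrite leNgt; apply/negP => /mmin; rewrite ltnn.
case: (ex_maxnP ex ub) => m /andP[mN mlt] mmax.
have := none (inord m); rewrite inordK // /is_mode mN mlt /=.
move/negP; apply; apply/forallP => j; apply/implyP => mj.
by rewrite leNgt; apply/negP => lt; have := mmax j.+1;
  rewrite /= ltn_ord lt ltnNge mj => /(_ isT).
Qed.

End Unimodal.

(* Main.v *)
Require Import Defs.
From mathcomp Require Import all_boot all_order all_algebra.

(** Deleting the last vertex of the tail, respectively its closed neighbourhood,
    gives [I(Tail n+2) = I(Tail n+1) + t I(Tail n)], where [Tail 0] is [G].
    If [P] and [Q] are unimodal with modes [a] and [b], [b <= a <= b+1], then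
    [P] and [tQ] peak at [a] and [b+1], two indices that are equal or
    consecutive with [a] first; hence [P + tQ] is unimodal. Its mode is the index
    of its last strict ascent: [P] ascends strictly into [a] and [tQ] weakly,
    while neither ascends after [a+1], so that mode is [a] or [a+1], and the
    hypothesis on modes propagates along the tail. *)

Set Implicit Arguments.
Unset Strict Implicit.
Unset Printing Implicit Defensive.

Import Order.TTheory GRing.Theory Num.Theory.
Local Open Scope ring_scope.

(** * Unimodal polynomials and their peaks *)

Section Peak.
Variable R : realDomainType.
Implicit Types p q : {poly R}.

(** Descent is imposed at every index, past the degree too, so that adding polynomials requires no
    degree computation. The strict ascent into [m] pins down the mode. *)
Definition peak p m :=
  [/\ forall i, 0 <= p`_i,
      coef_pred p m < p`_m,
      forall i, (i < m)%N -> p`_i <= p`_i.+1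
    & forall i, (m <= i)%N -> p`_i.+1 <= p`_i].

Lemma unimodal_peak p : unimodal p -> peak p (mode p).
Proof.
case=> p0 pge0 [m mN [up down]].
have /and3P[dN asc /forallP desc] := modeP p0 pge0.
(* A strict ascent into an index beyond [m] would contradict the descent from [m] on. *)
have le_m : (mode p <= m)%N.
  rewrite leqNgt; apply/negP; case: (mode p) dN asc => // j jN /=.
  by rewrite ltnS => asc mj; have := down j; rewrite mj jN leNgt asc => /(_ isT).
split=> // i hi; first by apply: up; exact: leq_trans hi le_m.
case: (ltnP i (deg p)) => iN; first exact: (implyP (desc (Ordinal iN)) hi).
(* From the degree on, the next coefficient is 0. *)
by rewrite (nth_default _ (leq_trans (leqSpred _) _)).
Qed.

Lemma coef_pred_ge0 p m : (forall i, 0 <= p`_i) -> 0 <= coef_pred p m.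
Proof. by move=> pge0; case: m => //=. Qed.

Lemma peak_unimodal p m : peak p m -> unimodal p /\ mode p = m.
Proof.
case=> pge0 asc up down.
have pm0 : p`_m != 0.
  by rewrite gt_eqF // (le_lt_trans (coef_pred_ge0 m pge0) asc).
have p0 : p != 0 by apply: contraNneq pm0 => ->; rewrite coef0.
have ms : (m < size p)%N by rewrite ltnNge; apply: contra pm0 => /leq_sizeP->.
have mN : (m <= deg p)%N by rewrite -ltnS; exact: leq_trans ms (leqSpred _).
split; first by split=> //; exists m => //; split=> // i /andP[/down].
apply: is_mode_uniq (modeP p0 pge0) _; rewrite /is_mode mN asc /=.
by apply/forallP => j; apply/implyP => /down.
Qed.

Lemma peak_addMX p q a b : peak p a -> peak q b -> (b <= a <= b.+1)%N ->
  exists2 c, peak (p + q * 'X) c & (a <= c <= a.+1)%N.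
Proof.
move=> [p0 pasc pup pdown] [q0 qasc qup qdown] /andP[ba ab].
set r := p + q * 'X.
have rE i : r`_i = p`_i + coef_pred q i by rewrite /r coefD coefMX; case: i.
have cq_up i : (i <= b)%N -> coef_pred q i <= coef_pred q i.+1.
  by case: i => //= i; exact: qup.
have cq_down i : (b < i)%N -> coef_pred q i.+1 <= coef_pred q i.
  by case: i => //= i; exact: qdown.
have r0 i : 0 <= r`_i by rewrite rE addr_ge0 // coef_pred_ge0.
have up i : (i < a)%N -> r`_i <= r`_i.+1.
  move=> ia; rewrite !rE lerD ?pup //; apply: cq_up.
  by rewrite -ltnS; exact: leq_trans ia ab.
have down i : (a < i)%N -> r`_i.+1 <= r`_i.
  move=> ai; rewrite !rE lerD ?pdown 1?ltnW //; apply: cq_down.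
  exact: leq_ltn_trans ba ai.
(* At [a = 0] the shifted summand contributes 0; otherwise [a <= b.+1] makes its ascent into [a]
   weak. *)
have asc : coef_pred r a < r`_a.
  case: (a) pasc ab => [|j] pj jb; rewrite rE /=.
    by rewrite addr0.
  by rewrite rE ltr_leD // cq_up.
(* Only the step from [a] to [a.+1] is still undecided; its direction selects the peak. *)
case: (lerP r`_a.+1 r`_a) => h.
  exists a; last by rewrite leqnn leqnSn.
  by split=> // i; rewrite leq_eqVlt => /predU1P[<-|/down].
exists a.+1; last by rewrite leqnn leqnSn.
by split=> // i; rewrite ltnS leq_eqVlt => /predU1P[->|/up] //; exact: ltW.
Qed.

End Peak.

(** * Counting independent sets *)

Lemma coef_indep_poly (G : sgraph) k :
  (indep_poly G)`_k = (indep_count G k)%:R.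
Proof.
rewrite coef_poly ltnS; case: leqP => // Gk; symmetry.
rewrite /indep_count (_ : [set S | _] = set0) ?cards0 //.
apply/setP => S; rewrite !inE; apply/negP => /andP[_ /eqP Sk].
by have := max_card S; rewrite Sk leqNgt Gk.
Qed.

Lemma independentP (G : sgraph) (S : {set G}) :
  reflect {in S &, forall x y, ~~ edge x y} (independent S).
Proof.
apply: (iffP 'forall_implyP) => [h x y xS yS|h x xS].
  by have /forall_inP := h x xS; exact.
by apply/forall_inP => y; exact: h.
Qed.

Lemma indep_count0 (G : sgraph) : indep_count G 0 = 1%N.
Proof.
apply/eqP/cards1P; exists set0; apply/setP => S; rewrite !inE cards_eq0.
case: eqP => [->|]; last by rewrite andbF.
by rewrite andbT; apply/independentP => x; rewrite inE.
Qed.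

(** Such an [f] identifies [H] with an induced subgraph of [K], so taking images is a bijection on
    independent sets. This compares counts across different vertex types. *)
Lemma indep_count_embed (H K : sgraph) (f : H -> K) k : injective f ->
  {mono f : x y / edge x y} ->
  #|[set S : {set K} | [&& independent S, #|S| == k & S \subset codom f]]|
    = indep_count H k.
Proof.
move=> f_inj f_edge.
rewrite /indep_count -(card_imset _ (imset_inj f_inj)); apply: eq_card => S.
have indep_im (T : {set H}) : independent (f @: T) = independent T.
  apply/independentP/independentP => h x y.
    by move=> xT yT; rewrite -f_edge h ?imset_f.
  by case/imsetP=> x' ? -> /imsetP[y' ? ->]; rewrite f_edge h.
rewrite !inE; apply/and3P/imsetP => [[Si Sk Sf]|[T]].
  have SE : f @: (f @^-1: S) = S.
    apply/setP => y; apply/imsetP/idP => [[x]|yS]; first by rewrite inE => ? ->.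
    by have /codomP[x yx] := subsetP Sf y yS; exists x; rewrite ?inE -?yx.
  by exists (f @^-1: S); rewrite ?inE -?indep_im -?(card_imset _ f_inj) SE ?Si.
rewrite inE => /andP[Ti Tk] ->; rewrite indep_im card_imset //; split=> //.
by apply/subsetP => _ /imsetP[x _ ->]; exact: codom_f.
Qed.

(** Either a set avoids [w], or removing [w] from it leaves an independent set outside the closed
    neighbourhood of [w]. *)
Lemma indep_count_split (K : sgraph) (w : K) k :
  indep_count K k.+1 =
    (#|[set S : {set K} | [&& independent S, #|S| == k.+1
                            & S \subset [pred x | x != w]]]|
     + #|[set S : {set K} | [&& independent S, #|S| == k
                            & S \subset [pred x | (x != w) && ~~ edge w x]]]|)%N.
Proof.
rewrite /indep_count -(cardsID [set S : {set K} | w \in S]) addnC.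
congr (_ + _)%N.
  apply: eq_card => S; rewrite !inE andbC -andbA; congr [&& _, _ & _].
  apply/idP/subsetP => [wS x xS|h].
    by rewrite inE; apply: contraNneq wS => <-.
  by apply/negP => /h; rewrite inE eqxx.
set B := [set S | [&& _, _ & _]].
have wB S : S \in B -> w \notin S.
  rewrite inE => /and3P[_ _ /subsetP Sw]; apply/negP => /Sw.
  by rewrite inE eqxx.
(* Members of [B] avoid [w], so inserting [w] is injective on [B]. *)
rewrite -(@card_in_imset _ _ (fun S => w |: S) B); last first.
  by move=> S T /wB wS /wB wT eqST; rewrite -(setU1K wS) eqST setU1K.
apply: eq_card => S; rewrite !inE; apply/andP/imsetP => [[/andP[Si Sk] wS]|].
  exists (S :\ w); last by rewrite setD1K.
  rewrite inE; apply/and3P; split.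
  - apply/independentP => x y /setD1P[_ xS] /setD1P[_ yS].
    exact: (independentP _ Si).
  - by rewrite (cardsD1 w) wS in Sk.
  - apply/subsetP => x /setD1P[xw xS]; rewrite inE xw.
    exact: (independentP _ Si).
case=> T TB ->; have wT := wB T TB; move: TB.
rewrite inE => /and3P[/independentP Ti Tk /subsetP Tw].
rewrite setU11 cardsU1 wT add1n eqSS Tk andbT; split=> //.
have nbr x : x \in T -> ~~ edge w x by move/Tw; rewrite inE => /andP[].
apply/independentP => x y /setU1P[->|xT] /setU1P[->|yT].
- by rewrite edge_irrefl.
- exact: nbr.
- by rewrite edge_sym nbr.
- exact: Ti.
Qed.

(** * The recurrence along the tail *)

Section TailRecurrence.
Variables (G : sgraph) (v : G).

Definition tail_widen m n (le_mn : (m <= n)%N) (x : Tail v m) : Tail v n :=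
  match x with inl a => inl a | inr i => inr (widen_ord le_mn i) end.

Lemma tail_widen_inj m n (le_mn : (m <= n)%N) : injective (tail_widen le_mn).
Proof.
by move=> [a|i] [b|j] //= => [[->]|[/val_inj->]].
Qed.

Lemma tail_widen_edge m n (le_mn : (m <= n)%N) :
  {mono tail_widen le_mn : x y / edge x y}.
Proof. by move=> [a|i] [b|j]. Qed.

Lemma codom_tail_widen m n (le_mn : (m <= n)%N) (x : Tail v n) :
  (x \in codom (tail_widen le_mn)) = if x is inr j then (j < m)%N else true.
Proof.
case: x => [a|j]; first by apply/codomP; exists (inl a).
apply/codomP/idP => [[[//|i] [->]] /=|jm]; first exact: ltn_ord.
by exists (inr (Ordinal jm)); congr inr; exact: val_inj.
Qed.

Lemma indep_count_tail0 k : indep_count (Tail v 0) k = indep_count G k.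
Proof.
rewrite -(@indep_count_embed G (Tail v 0) inl) //; last by move=> x y [].
apply: eq_card => S; rewrite !inE; congr (_ && _); rewrite -[LHS]andbT.
congr (_ && _); apply/esym/subsetP => -[a _|[]//].
exact: codom_f.
Qed.

(** Split at the end vertex of the path: its only neighbour is the preceding path vertex, so the two
    remaining graphs are the tails of lengths [n.+1] and [n]. *)
Lemma indep_count_tail n k :
  indep_count (Tail v n.+2) k.+1 =
    (indep_count (Tail v n.+1) k.+1 + indep_count (Tail v n) k)%N.
Proof.
have le2 : (n <= n.+2)%N by rewrite ltnW.
rewrite (@indep_count_split (Tail v n.+2) (inr ord_max)).
rewrite -(indep_count_embed _ (@tail_widen_inj _ _ (leqnSn n.+1))
            (@tail_widen_edge _ _ _)).
rewrite -(indep_count_embed _ (@tail_widen_inj _ _ le2)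
            (@tail_widen_edge _ _ _)).
congr (_ + _)%N; apply: eq_card => S; rewrite !inE; congr [&& _, _ & _];
  apply: eq_subset_r => x; rewrite codom_tail_widen inE.
  case: x => [//|j]; rewrite -[inr j == _]/(j == ord_max) -val_eqE /=.
  by rewrite ltn_neqAle -ltnS ltn_ord andbT.
(* The end vertex has index [n.+1], not 0, so it is not adjacent to [G]. *)
case: x => [a|j] /=; first by rewrite andbF.
rewrite -[inr j == _]/(j == ord_max) -val_eqE /= eqSS.
rewrite (gtn_eqF (ltn_ord j)) /=.
rewrite [RHS]ltn_neqAle -[(j <= n)%N]ltnS.
by rewrite [(j < n.+1)%N]ltn_neqAle -ltnS ltn_ord andbT andbC.
Qed.

Lemma indep_poly_tail0 : indep_poly (Tail v 0) = indep_poly G.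
Proof. by apply/polyP => k; rewrite !coef_indep_poly indep_count_tail0. Qed.

Lemma indep_poly_tail n :
  indep_poly (Tail v n.+2) = indep_poly (Tail v n.+1) + indep_poly (Tail v n) * 'X.
Proof.
apply/polyP => -[|k]; rewrite coefD coefMX !coef_indep_poly /=.
  by rewrite !indep_count0 addr0.
by rewrite indep_count_tail natrD.
Qed.

End TailRecurrence.

Theorem theorem3p2 (G : sgraph) (v : G)
    (hunim1 : unimodal (indep_poly (Tail v 1)))
    (hunim : unimodal (indep_poly G))
    (hmode : (mode (indep_poly G) <= mode (indep_poly (Tail v 1))
                <= (mode (indep_poly G)).+1)%N) :
  (forall n : nat, (1 <= n)%N -> unimodal (indep_poly (Tail v n))) /\
  (forall n : nat, (2 <= n)%N ->
     (mode (indep_poly (Tail v n.-1)) <= mode (indep_poly (Tail v n))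
        <= (mode (indep_poly (Tail v n.-1))).+1)%N).
Proof.
(* The recurrence has order two, so the induction carries two consecutive tails. It starts at
   [n = 0], where the claim is exactly the hypotheses. *)
have main n : [/\ unimodal (indep_poly (Tail v n)),
    unimodal (indep_poly (Tail v n.+1))
  & (mode (indep_poly (Tail v n)) <= mode (indep_poly (Tail v n.+1))
       <= (mode (indep_poly (Tail v n))).+1)%N].
  elim: n => [|n [uq up hm]]; first by rewrite indep_poly_tail0.
  have [c hc hac] := peak_addMX (unimodal_peak up) (unimodal_peak uq) hm.
  by rewrite indep_poly_tail; have [ur ->] := peak_unimodal hc.
split=> [n _|[//|n] _] /=; first by have [] := main n.
by have [] := main n.
Qed.
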